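(* Let $M_1$ and $M_2$ be two means satisfying $Q_{M_1}(x)>Q_{M_2}(x)$ for all $x\in(0,+\infty)$. Then near the first bisector $M_1\ge M_2$; that is, there is an open neighborhood $U$ of $\{(x,x):x>0\}$ in $(0,+\infty)^2$ such that $M_1(x,y)\ge M_2(x,y)$ for all $(x,y)\in U$.
   Context: A mean is a function $M:(0,+\infty)^2\to(0,+\infty)$ of class $C^\infty$ such that $\min(x,y)\le M(x,y)\le\max(x,y)$ and $M(x,y)=M(y,x)$ for all $x,y>0$. The characteristic function of a mean $M$ is $Q_M:(0,+\infty)\to\mathbb{R}$, $Q_M(x):=\frac{\partial^2 M}{\partial x^2}(x,x)$ (second partial derivative with respect to the first variable, evaluated at $(x,x)$). *)

(* Defs.v *)
From Stdlib Require Import Reals.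
From Coquelicot Require Import Coquelicot.
Open Scope R_scope.

(* A function on (0,+oo)^2 is represented by a total function R -> R -> R whose
   values outside the open quadrant are irrelevant: every clause below only
   concerns points of the quadrant, and since the quadrant is open, continuity
   and derivatives there do not see the values outside it. *)

(* ex_diff_n f n x y says that all iterated partial derivatives of f of order
   at most n, in every order of differentiation, exist and are continuous at
   (x, y). *)
Definition smooth_on_quadrant (f : R -> R -> R) : Prop :=
  forall (n : nat) (x y : R), 0 < x -> 0 < y -> ex_diff_n f n x y.

Record is_mean (M : R -> R -> R) : Prop := {
  mean_pos : forall x y : R, 0 < x -> 0 < y -> 0 < M x y;
  mean_smooth : smooth_on_quadrant M;
  mean_between : forall x y : R, 0 < x -> 0 < y ->
    Rmin x y <= M x y <= Rmax x y;
  mean_sym : forall x y : R, 0 < x -> 0 < y -> M x y = M y x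
}.

Definition charfun (M : R -> R -> R) (x : R) : R := partial_derive 2 0 M x x.

(* Main.v *)
Require Import Defs.
From Stdlib Require Import Reals Lra.
From Coquelicot Require Import Coquelicot.
Open Scope R_scope.

(** The proof compares the Taylor expansions of [M1] and [M2] in the first
    variable at a point of the first bisector.  Any mean [M] satisfies
    [M y y = y], and differentiating this identity along the bisector gives
    the value [1] for the sum of the two first partial derivatives at [(y, y)];
    symmetry makes them equal, so both are [1/2] ([mean_Derive_diag]).

    Hence, for fixed [y], the function [u => M1 u y - M2 u y] vanishes at [y]
    together with its first derivative.  Its second derivative is positive at
    [(a, a)] by hypothesis on the characteristic functions, and therefore, by
    continuity, on a square centred at [(a, a)].  When [(x, y)] lies in this
    square, so does the horizontal segment from [(y, y)] to [(x, y)]; convexity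
    along it gives [M1 x y - M2 x y >= 0] ([nonneg_of_flat_convex]).  The
    wanted open set is the interior of the set of points of the quadrant at
    which the inequality holds. *)

(** A convex function lies above its tangent, here the zero function: the mean
    value theorem is applied to [g] and then to [g'], and the signs of the two
    displacements agree whether [x] is to the left or to the right of [c]. *)
Lemma nonneg_of_flat_convex (g g' g'' : R -> R) (c x : R) :
  (forall u, Rmin c x <= u <= Rmax c x -> is_derive g u (g' u)) ->
  (forall u, Rmin c x <= u <= Rmax c x -> is_derive g' u (g'' u)) ->
  (forall u, Rmin c x <= u <= Rmax c x -> 0 <= g'' u) ->
  g c = 0 -> g' c = 0 -> 0 <= g x.
Proof.
  intros Dg Dg' pos gc g'c.
  assert (cont : forall (f df : R -> R) u, is_derive f u (df u) ->
                   continuity_pt f u).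
  { intros f df u D. apply derivable_continuous_pt.
    exists (df u). now apply is_derive_Reals. }
  destruct (MVT_gen g c x g') as [xi [Hxi Exi]].
  { intros u Hu. apply Dg. lra. }
  { intros u Hu. apply (cont g g'). now apply Dg. }
  assert (sub : forall u, Rmin c xi <= u <= Rmax c xi ->
                  Rmin c x <= u <= Rmax c x).
  { intros u. revert Hxi. unfold Rmin, Rmax.
    destruct (Rle_dec c x), (Rle_dec c xi); lra. }
  destruct (MVT_gen g' c xi g'') as [eta [Heta Eeta]].
  { intros u Hu. apply Dg'. apply sub. lra. }
  { intros u Hu. apply (cont g' g''). apply Dg'. now apply sub. }
  replace (g x) with (g'' eta * ((xi - c) * (x - c))).
  2:{ transitivity (g' xi * (x - c)); [|lra].
      replace (g' xi) with (g'' eta * (xi - c)) by lra. ring. }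
  apply Rmult_le_pos; [now apply pos, sub|].
  revert Hxi. unfold Rmin, Rmax. destruct (Rle_dec c x); intros [H1 H2].
  - apply Rmult_le_pos; lra.
  - replace ((xi - c) * (x - c)) with ((c - xi) * (c - x)) by ring.
    apply Rmult_le_pos; lra.
Qed.

Lemma locally_pos (a : R) : 0 < a -> locally a (fun u => 0 < u).
Proof. exact (open_gt 0 a). Qed.

Lemma locally_2d_quadrant (a b : R) :
  0 < a -> 0 < b -> locally_2d (fun u v => 0 < u /\ 0 < v) a b.
Proof.
  intros Ha Hb. exists (mkposreal _ (Rmin_pos _ _ Ha Hb)). simpl.
  intros u v Hu Hv. pose proof (Rmin_l a b). pose proof (Rmin_r a b).
  apply Rabs_def2 in Hu. apply Rabs_def2 in Hv. lra.
Qed.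

Lemma mean_diag (M : R -> R -> R) (x : R) : is_mean M -> 0 < x -> M x x = x.
Proof.
  intros hM Hx. destruct (mean_between _ hM x x Hx Hx) as [H1 H2].
  rewrite Rmin_left in H1 by lra. rewrite Rmax_left in H2 by lra. lra.
Qed.

(** The chain rule along the bisector needs differentiability of [M] as a
    function of two variables, which holds because a first partial derivative
    is continuous. *)
Lemma mean_Derive_diag (M : R -> R -> R) (a : R) :
  is_mean M -> 0 < a -> Derive (fun u => M u a) a = 1 / 2.
Proof.
  intros hM Ha.
  destruct (mean_smooth _ hM 2%nat a a Ha Ha) as (_ & _ & ex2 & (cont & _) & _).
  assert (sym : Derive (M a) a = Derive (fun u => M u a) a).
  { apply Derive_ext_loc. generalize (locally_pos a Ha). apply filter_imp.
    intros u Hu. now apply (mean_sym _ hM). }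
  assert (diff : differentiable_pt_lim M a a
            (Derive (fun u => M u a) a) (Derive (M a) a)).
  { apply filterdiff_differentiable_pt_lim.
    apply (is_derive_filterdiff M a a (fun u v => Derive (fun z => M z v) u)).
    - generalize (proj1 (locally_2d_locally _ _ _)
                    (locally_2d_quadrant a a Ha Ha)).
      apply filter_imp. intros [u v] [Hu Hv]. simpl in *.
      apply Derive_correct.
      now destruct (mean_smooth _ hM 1%nat u v Hu Hv) as (_ & ex & _).
    - now apply Derive_correct.
    - now apply continuity_2d_pt_filterlim in cont. }
  pose proof (derivable_pt_lim_comp_2d M (fun t => t) (fun t => t) a _ _ 1 1
                diff (derivable_pt_lim_id a) (derivable_pt_lim_id a)) as chain.
  apply is_derive_Reals in chain. apply is_derive_unique in chain.
  assert (one : Derive (fun t => M t t) a = 1).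
  { rewrite (Derive_ext_loc _ (fun t => t)); [apply Derive_id|].
    generalize (locally_pos a Ha). apply filter_imp.
    intros u Hu. now apply mean_diag. }
  lra.
Qed.

(** The local comparison: the square around [(a, a)] supplied by continuity of
    the second derivatives contains, with [(x, y)], every [(u, y)] with [u]
    between [y] and [x]. *)
Lemma mean_le_near_diag (M1 M2 : R -> R -> R) (a : R) :
  is_mean M1 -> is_mean M2 -> 0 < a -> charfun M2 a < charfun M1 a ->
  locally_2d (fun x y => M2 x y <= M1 x y) a a.
Proof.
  intros hM1 hM2 Ha hQ.
  set (D1 := fun (M : R -> R -> R) u v => Derive (fun z => M z v) u).
  set (D2 := fun M => D1 (D1 M)).
  assert (C2 : forall M, is_mean M -> continuity_2d_pt (D2 M) a a).
  { intros M hM.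
    now destruct (mean_smooth _ hM 2%nat a a Ha Ha)
      as (_ & _ & _ & (_ & _ & _ & (cont & _) & _) & _). }
  assert (ex : forall M u v, is_mean M -> 0 < u -> 0 < v ->
             is_derive (fun z => M z v) u (D1 M u v) /\
             is_derive (fun z => D1 M z v) u (D2 M u v)).
  { intros M u v hM Hu Hv.
    destruct (mean_smooth _ hM 2%nat u v Hu Hv)
      as (_ & ex1 & _ & (_ & ex2 & _) & _).
    split; now apply Derive_correct. }
  assert (gap : 0 < D2 M1 a a - D2 M2 a a).
  { unfold charfun in hQ. change (D2 M2 a a < D2 M1 a a) in hQ. lra. }
  destruct (continuity_2d_pt_minus _ _ _ _ (C2 M1 hM1) (C2 M2 hM2)
              (mkposreal _ gap)) as [d1 Hd1].
  destruct (locally_2d_quadrant a a Ha Ha) as [d2 Hd2].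
  exists (mkposreal _ (Rmin_pos _ _ (cond_pos d1) (cond_pos d2))). simpl.
  intros x y Hx Hy.
  pose proof (Rmin_l d1 d2). pose proof (Rmin_r d1 d2).
  assert (Hseg : forall u, Rmin y x <= u <= Rmax y x ->
            0 < u /\ 0 < y /\ 0 < D2 M1 u y - D2 M2 u y).
  { intros u Hu.
    assert (Hua : Rabs (u - a) < Rmin d1 d2).
    { apply Rabs_def2 in Hx. apply Rabs_def2 in Hy. revert Hu.
      unfold Rmin at 1, Rmax. destruct (Rle_dec y x); intros Hu;
        apply Rabs_def1; lra. }
    destruct (Hd2 u y) as [Hu0 Hy0]; [lra..|].
    specialize (Hd1 u y ltac:(lra) ltac:(lra)). simpl in Hd1.
    apply Rabs_def2 in Hd1. lra. }
  assert (Hy0 : 0 < y) by (apply (Hseg x); split; [apply Rmin_r|apply Rmax_r]).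
  enough (0 <= M1 x y - M2 x y) by lra.
  apply (nonneg_of_flat_convex (fun u => M1 u y - M2 u y)
           (fun u => D1 M1 u y - D1 M2 u y)
           (fun u => D2 M1 u y - D2 M2 u y) y x).
  - intros u Hu. destruct (Hseg u Hu) as (Hu0 & _).
    apply (is_derive_minus (fun u => M1 u y) (fun u => M2 u y));
      now apply ex.
  - intros u Hu. destruct (Hseg u Hu) as (Hu0 & _).
    apply (is_derive_minus (fun u => D1 M1 u y) (fun u => D1 M2 u y));
      now apply ex.
  - intros u Hu. apply Rlt_le. now apply Hseg.
  - rewrite !mean_diag by assumption. ring.
  - unfold D1. rewrite !mean_Derive_diag by assumption. ring.
Qed.

Theorem proposition2p27 (M1 M2 : R -> R -> R)
  (hM1 : is_mean M1) (hM2 : is_mean M2)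
  (hQ : forall x : R, 0 < x -> charfun M1 x > charfun M2 x) :
  exists U : R * R -> Prop,
    open U /\
    (forall x y : R, U (x, y) -> 0 < x /\ 0 < y) /\
    (forall x : R, 0 < x -> U (x, x)) /\
    (forall x y : R, U (x, y) -> M1 x y >= M2 x y).
Proof.
  set (P := fun p : R * R =>
              (0 < fst p /\ 0 < snd p) /\ M2 (fst p) (snd p) <= M1 (fst p) (snd p)).
  exists (fun p => locally p P).
  repeat split.
  - intros p. apply locally_locally.
  - now apply locally_singleton in H as [[H _] _].
  - now apply locally_singleton in H as [[_ H] _].
  - intros x Hx. apply filter_and.
    + apply (locally_2d_locally (fun u v => 0 < u /\ 0 < v)).
      now apply locally_2d_quadrant.
    + apply (locally_2d_locally (fun u v => M2 u v <= M1 u v)).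
      now apply mean_le_near_diag, hQ.
  - intros x y H. apply locally_singleton in H as [_ H]. now apply Rle_ge.
Qed.
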